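(* Let $G$ be a finite cyclic group of order $n\geq 3$ and let $H\neq\{e\}$ be a subgroup of $G$. Then the generalized non-coprime graph $\Gamma_{G,H}$ is unicyclic if and only if $H=G$ with $G\cong\mathbb{Z}_4$.
   Context: For a finite group $G$ with identity $e$ and a subgroup $H\neq\{e\}$ of $G$, the generalized non-coprime graph $\Gamma_{G,H}$ is the simple undirected graph with vertex set $G\setminus\{e\}$ in which two distinct vertices $a,b$ are adjacent if and only if $\gcd(|a|,|b|)\neq 1$ and ($a\in H$ or $b\in H$), where $|a|$ denotes the order of the element $a$. A graph is unicyclic if it contains exactly one cycle. *)

(* Defs.v *)
From mathcomp Require Import all_boot all_fingroup all_solvable.

Set Implicit Arguments.
Unset Strict Implicit.
Unset Printing Implicit Defensive.

Local Open Scope group_scope.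

Record sgraph := SGraph {
  vertex : finType;
  adj : rel vertex;
  adj_sym : symmetric adj;
  adj_irrefl : irreflexive adj }.

(* [next s] wraps around, so the closing edge is included. *)
Definition cycle_edges (T : finType) (s : seq T) : {set {set T}} :=
  [set [set x; next s x] | x in s].

(* A cycle is a subgraph, represented by its edge set: rotations and reversals
   of a closed vertex sequence yield the same cycle.  The bound on the size
   excludes the degenerate sequences [:: x] and [:: x; y]. *)
Definition is_cycle (D : sgraph) (C : {set {set vertex D}}) : Prop :=
  exists s : seq (vertex D),
    [/\ (2 < size s)%N, ucycle (@adj D) s & C = cycle_edges s].

Definition unicyclic (D : sgraph) : Prop :=
  exists! C : {set {set vertex D}}, is_cycle C.

Section NonCoprimeGraph.

Variables (gT : finGroupType) (G H : {group gT}).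

Definition ncg_vertex : finType := {x : gT | x \in G^#}.

Definition ncg_adj : rel ncg_vertex := fun a b =>
  [&& a != b, gcdn #[val a] #[val b] != 1%N & (val a \in H) || (val b \in H)].

Lemma ncg_adj_sym : symmetric ncg_adj.
Proof. by move=> a b; rewrite /ncg_adj eq_sym gcdnC orbC. Qed.

Lemma ncg_adj_irrefl : irreflexive ncg_adj.
Proof. by move=> a; rewrite /ncg_adj eqxx. Qed.

Definition gen_noncoprime_graph : sgraph := SGraph ncg_adj_sym ncg_adj_irrefl.

End NonCoprimeGraph.

(* Main.v *)
Require Import Defs.
From mathcomp Require Import all_boot all_algebra all_fingroup all_solvable.

Set Implicit Arguments.
Unset Strict Implicit.
Unset Printing Implicit Defensive.

Local Open Scope group_scope.

(** Let [m] be the order of [H].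

    If [m = 2], every edge contains the involution of [H], so the graph is a
    star with some isolated vertices and has no cycle ([star_acyclic]).

    If [m > 2], a generator [h] of [H] differs from its inverse, both lie in
    [H], and each is adjacent to every other vertex whose order is not coprime
    to [m].  Hence each such vertex [u] outside [{h, h^-1}] closes a triangle
    [h, h^-1, u], and two of them give two cycles ([two_apices]).  If [H] is
    proper in [G], a generator of [G] and its inverse are two such vertices.
    If [H = G], all the [n - 3] remaining nontrivial elements are, so a
    unicyclic graph forces [n <= 4]; and [n = 3] leaves only two vertices, too
    few for a cycle.

    Conversely, when [G = H] has order 4 all nontrivial orders are even, so the
    graph is complete on three vertices, and its only cycle consists of all the
    2-element sets ([unicyclic_triangle]). *)

(** * Cycles in simple graphs *)

Section Cycles.

Variable D : sgraph.
Implicit Types (C : {set {set vertex D}}) (a b u v h : vertex D).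

(** The vertex set of a cycle can be read off its edge set; this is what tells
    two triangles apart. *)
Lemma cover_cycle_edges (T : finType) (s : seq T) :
  cover (cycle_edges s) = [set x in s].
Proof.
apply/setP => x; rewrite inE; apply/bigcupP/idP => [[e]|xs].
  by case/imsetP=> y ys ->; rewrite !inE => /orP[]/eqP-> //; rewrite mem_next.
by exists [set x; next s x]; [apply/imsetP; exists x | rewrite !inE eqxx].
Qed.

Lemma cycle_edges3 (T : finType) (x y z : T) : uniq [:: x; y; z] ->
  cycle_edges [:: x; y; z] = [set [set x; y]; [set y; z]; [set z; x]].
Proof.
rewrite /= !inE negb_or andbT => /andP[/andP[xy xz] yz].
have [nx ny nz] : [/\ next [:: x; y; z] x = y, next [:: x; y; z] y = z
                    & next [:: x; y; z] z = x].
  by rewrite /= !eqxx ![_ == x]eq_sym (negPf xy) (negPf xz)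
             eq_sym (negPf yz).
apply/setP => e; rewrite !inE; apply/imsetP/idP => [[w]|].
  rewrite !inE => /or3P[]/eqP-> ->; rewrite ?nx ?ny ?nz eqxx ?orbT //.
case/orP=> [/orP[]|] /eqP->; [exists x | exists y | exists z];
  by rewrite ?nx ?ny ?nz // !inE eqxx ?orbT.
Qed.

Lemma triangle_is_cycle a b u :
  adj a b -> adj b u -> adj u a -> is_cycle (cycle_edges [:: a; b; u]).
Proof.
move=> ab bu ua; exists [:: a; b; u]; split=> //.
have neq x y : @adj D x y -> x != y.
  by apply: contraTneq => ->; rewrite adj_irrefl.
rewrite /ucycle /= ab bu ua /= !inE negb_or neq // (neq b u) //=.
by rewrite eq_sym neq.
Qed.

Lemma two_triangles_not_unicyclic a b u v : adj a b ->
  adj b u -> adj u a -> adj b v -> adj v a -> u != v -> ~ unicyclic D.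
Proof.
move=> ab bu ua bv va uv [C [_ uniqC]].
have eqC : cycle_edges [:: a; b; u] = cycle_edges [:: a; b; v].
  by rewrite -(uniqC _ (triangle_is_cycle ab bu ua));
     apply: uniqC; apply: triangle_is_cycle.
have : u \in [set x in [:: a; b; v]].
  by rewrite -cover_cycle_edges -eqC cover_cycle_edges !inE eqxx !orbT.
rewrite !inE (negPf uv) orbF => /orP[]/eqP eq_u.
  by move: ua; rewrite eq_u adj_irrefl.
by move: bu; rewrite eq_u adj_irrefl.
Qed.

(** Among the first three edges of a cycle, two are disjoint or all three form
    a triangle; in neither case do they share a vertex. *)
Lemma star_acyclic h C :
  (forall a b, adj a b -> a = h \/ b = h) -> ~ is_cycle C.
Proof.
move=> star [[|x [|y [|z s]]]] [] // _ /andP[cyc us] _.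
move: cyc us; case: s => [|w s] /=.
  case/and4P=> xy yz zx _; rewrite !inE negb_or.
  case/and3P=> /andP[/eqP nxy /eqP nxz] /eqP nyz _.
  by case: (star _ _ xy) (star _ _ yz) (star _ _ zx) => ? [] ? [] ?; congruence.
case/and4P=> xy _ zw _; rewrite !inE !negb_or.
case/and4P=> /and4P[_ /eqP nxz /eqP nxw _] /and3P[/eqP nyz /eqP nyw _] _ _.
by case: (star _ _ xy) (star _ _ zw) => ? [] ?; congruence.
Qed.

Lemma card_vertex_cycle C : is_cycle C -> 2 < #|vertex D|.
Proof.
case=> s [s_gt2 /andP[_ us] _]; apply: leq_trans s_gt2 _.
by rewrite -(card_uniqP us) max_card.
Qed.

(** A cycle visits at least three vertices, hence all of them here, and any two
    points of a cyclic sequence of length 3 are consecutive. *)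
Lemma cycle_edges_card3 C : #|vertex D| = 3 -> is_cycle C ->
  C = [set e : {set vertex D} | #|e| == 2].
Proof.
move=> card3 [s [s_gt2 /andP[_ us] ->]].
have size_s : size s = 3.
  by apply/eqP; rewrite eqn_leq s_gt2 -card3 -(card_uniqP us) max_card.
have s_full x : x \in s.
  have /subset_leqif_card[_] : s \subset vertex D by apply/subsetP.
  by rewrite (card_uniqP us) size_s card3 eqxx => /esym/subsetP; apply.
case: s us s_full size_s {s_gt2} => [|x [|y [|z []]]] // us s_full _.
rewrite cycle_edges3 //; move: us; rewrite /= !inE negb_or andbT.
case/andP=> /andP[xy xz] yz.
apply/setP => e; rewrite !inE; apply/idP/cards2P => [|[a [b [ab ->]]]].
  case/orP=> [/orP[]|] /eqP->; [exists x, y | exists y, z | exists z, x] => //.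
  by rewrite eq_sym.
move: (s_full a) (s_full b) ab; rewrite !inE.
case/or3P=> /eqP-> /or3P[]/eqP->; rewrite ?eqxx // => _;
  by rewrite ?[[set y; x]]setUC ?[[set z; y]]setUC ?[[set x; z]]setUC
             ?eqxx ?orbT.
Qed.

Lemma unicyclic_triangle : #|vertex D| = 3 ->
  (forall a b, a != b -> adj a b) -> unicyclic D.
Proof.
move=> card3 complete.
have : uniq (enum (vertex D)) by apply: enum_uniq.
have : size (enum (vertex D)) = 3 by rewrite -cardE.
case: (enum _) => [|x [|y [|z []]]] //= _.
rewrite !inE negb_or andbT => /andP[/andP[xy xz] yz].
have cyc : is_cycle (cycle_edges [:: x; y; z]).
  by apply: triangle_is_cycle; apply: complete; rewrite // eq_sym.
exists (cycle_edges [:: x; y; z]); split=> // C' cyc'.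
by rewrite (cycle_edges_card3 card3 cyc) (cycle_edges_card3 card3 cyc').
Qed.

End Cycles.

(** * Cycles in the non-coprime graph *)

Section NonCoprime.

Variables (gT : finGroupType) (G H : {group gT}).
Hypothesis sHG : H \subset G.

Local Notation Gamma := (gen_noncoprime_graph G H).

Lemma card_ncg_vertex : #|vertex Gamma| = #|G|.-1.
Proof. by rewrite /= card_sig (cardsD1 1 G) group1; apply: eq_card. Qed.

Lemma ncg_acyclic_card2 C : #|H| = 2 -> ~ @is_cycle Gamma C.
Proof.
move=> oH; have ntH : H :!=: 1 by rewrite -cardG_gt1 oH.
have [h hH nt_h] := trivgPn _ ntH.
have hG : h \in G^# by rewrite !inE nt_h (subsetP sHG).
have onlyh x : x \in H -> x != 1 -> x = h.
  (* [H] has no room for [1], [h] and a third element. *)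
  move=> xH nt_x; apply/eqP; apply: contraTT isT => nxh.
  have : #|[set 1; h; x]| <= #|H|.
    by apply/subset_leq_card/subsetP=> y; rewrite !inE;
       case/orP=> [/orP[]|] /eqP->.
  rewrite -setUA cardsU1 cards2 !inE negb_or oH.
  by rewrite [1 == h]eq_sym [1 == x]eq_sym [h == x]eq_sym nt_h nt_x nxh.
apply: (@star_acyclic Gamma (exist _ h hG : vertex Gamma)).
move=> a b /and3P[_ _ /orP[]] inH; [left | right]; apply: val_inj;
  apply: onlyh => //; by [case/setD1P: (valP a) | case/setD1P: (valP b)].
Qed.

(** The edge from [h] to its inverse lies in a triangle with apex [u] and in
    another one with apex [v]. *)
Lemma two_apices h u v : h \in H -> u \in G -> v \in G ->
  uniq [:: h; h^-1; u; v] -> ~~ coprime #[u] #[h] -> ~~ coprime #[v] #[h] ->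
  ~ unicyclic Gamma.
Proof.
move=> hH uG vG; rewrite /= !inE !negb_or andbT.
case/and3P=> /and3P[hhV hu hv] /andP[hVu hVv] uv ncu ncv.
have nt x : ~~ coprime #[x] #[h] -> x != 1.
  by apply: contraNneq => ->; rewrite order1 coprime1n.
have nt_h : h != 1 by apply: contraNneq hhV => ->; rewrite invg1.
have hG : h \in G^# by rewrite !inE nt_h (subsetP sHG).
have hVG : h^-1 \in G^# by rewrite !inE invg_eq1 nt_h groupV (subsetP sHG).
have uG1 : u \in G^# by rewrite !inE nt.
have vG1 : v \in G^# by rewrite !inE nt.
apply: (@two_triangles_not_unicyclic Gamma (exist _ h hG : vertex Gamma)
  (exist _ h^-1 hVG : vertex Gamma) (exist _ u uG1 : vertex Gamma)
  (exist _ v vG1 : vertex Gamma)).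
all: rewrite /= /ncg_adj -?val_eqE /= ?orderV ?groupV ?hH ?orbT ?andbT //.
- by rewrite hhV gcdnn order_eq1.
- by rewrite hVu gcdnC.
- by rewrite eq_sym hu.
- by rewrite hVv gcdnC.
- by rewrite eq_sym hv.
Qed.

End NonCoprime.

(** * Cyclic groups *)

Lemma order_gt2_neqV (gT : finGroupType) (x : gT) : 2 < #[x] -> x != x^-1.
Proof.
move=> x_gt2; rewrite eq_sym eq_invg_mul -expg2 -order_dvdn.
by apply: contraL x_gt2 => /dvdn_leq; rewrite -leqNgt; apply.
Qed.

Lemma isog_Z4 (gT : finGroupType) (G : {group gT}) :
  cyclic G -> (G \isog [set: 'Z_4]) = (#|G| == 4).
Proof.
move=> cycG; rewrite isog_cyclic_card //= cardsT card_ord eq_sym.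
by rewrite Zp_cycle cycle_cyclic.
Qed.

Theorem theorem2p8 (gT : finGroupType) (G H : {group gT}) (n : nat)
    (cycG : cyclic G) (oG : #|G| = n) (n_ge3 : (3 <= n)%N)
    (sHG : H \subset G) (ntH : H :!=: 1) :
  unicyclic (gen_noncoprime_graph G H) <->
  (H :=: G /\ G \isog [set: 'Z_4]).
Proof.
rewrite isog_Z4 // oG; split=> [uni | [eqHG /eqP n4]]; last first.
  apply: unicyclic_triangle => [|a b ab].
    by rewrite card_ncg_vertex oG n4.
  have even (c : ncg_vertex G) : 2 %| #[val c].
    have /setD1P[nt_c cG] := valP c.
    have : #[val c] \in divisors 4.
      by rewrite -dvdn_divisors // -n4 -oG order_dvdG.
    by move: nt_c; rewrite -order_eq1 /= !inE => /negPf-> /= /orP[]/eqP->.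
  rewrite /= /ncg_adj ab eqHG; have /setD1P[_ ->] := valP a; rewrite andbT /=.
  have : 2 %| gcdn #[val a] #[val b] by rewrite dvdn_gcd !even.
  by apply: contraTneq => ->.
have [C [cycC _]] := uni.
have oH_gt2 : 2 < #|H|.
  rewrite ltn_neqAle cardG_gt1 ntH andbT; apply/eqP => /esym oH.
  exact: ncg_acyclic_card2 oH cycC.
have /cyclicP[h defH] := cyclicS sHG cycG.
have hH : h \in H by rewrite defH cycle_id.
have hhV : h != h^-1 by rewrite order_gt2_neqV // orderE -defH.
have [eqHG | neqHG] := eqVneq (H : {set gT}) G; last first.
  have /cyclicP[g defG] := cycG.
  have gG : g \in G by rewrite defG cycle_id.
  have ggV : g != g^-1 by rewrite order_gt2_neqV // orderE -defG oG.
  (* A generator of [G] lying in [H] would give [H = G]. *)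
  have gNH : g \notin H.
    by apply: contra neqHG => gH; rewrite eqEsubset sHG defG cycle_subG.
  have nc : ~~ coprime #[g] #[h].
    rewrite /coprime (gcdn_idPr _) ?order_eq1.
      by apply: contraNneq hhV => ->; rewrite invg1.
    by rewrite [#[g]]orderE -defG order_dvdG // (subsetP sHG).
  have neq x y : x \in H -> y \notin H -> x != y.
    by move=> xH; apply: contraNneq => <-.
  case: (@two_apices _ G H sHG h g g^-1 hH gG _ _ nc _ uni);
    rewrite ?groupV ?orderV //= !inE !negb_or hhV ggV /=.
  by rewrite !neq ?groupV.
split=> //.
have n_gt3 : 3 < n.
  have := card_vertex_cycle cycC.
  by rewrite card_ncg_vertex oG -ltnS prednK // -oG cardG_gt0.
rewrite eqn_leq n_gt3 andbT leqNgt; apply/negP => n_gt4.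
pose S := G^# :\ h :\ h^-1.
have S_gt1 : 1 < #|S|.
  have := n_gt4; rewrite -oG (cardsD1 1 G) group1 (cardsD1 h G^#).
  rewrite (cardsD1 h^-1 (G^# :\ h)) -/S addnA addnA.
  (* Removing [1], [h] and [h^-1] from [G] costs at most three elements. *)
  by do 2![case: (_ \in _)] => /=; rewrite ?addn0 ?addnS => // /ltnW;
    rewrite ?ltnS // => /ltnW.
have [u [v [uS vS uv]]] := card_gt1P S_gt1.
have nc x : x \in S -> ~~ coprime #[x] #[h].
  rewrite !inE => /and4P[_ _ nt_x xG]; rewrite /coprime (gcdn_idPl _) ?order_eq1 //.
  by rewrite [#[h]]orderE -defH eqHG order_dvdG.
case: (@two_apices _ G H sHG h u v hH _ _ _ (nc _ uS) (nc _ vS) uni).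
- by case/setD1P: uS => _ /setD1P[_ /setD1P[]].
- by case/setD1P: vS => _ /setD1P[_ /setD1P[]].
move: uS vS; rewrite /= !inE !negb_or hhV uv !(eq_sym h) !(eq_sym h^-1).
by case/and4P=> -> -> _ _ /and4P[-> -> _ _].
Qed.
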